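(* Let $L/K$ be a separable field extension of degree $6$ with $\mathrm{char}(K) = 2$. Assume that one of the following holds: (a) there exists an intermediate field $K \subset L' \subset L$ with $[L':K] = 3$; or (b) $K$ is a $C_1$-field. Then there is a generator $y \in L$ of $L/K$ (i.e. $L = K(y)$) satisfying $\sigma_1(y) = \sigma_3(y) = 0$; equivalently, the minimal polynomial of $y$ over $K$ has the form $t^6 + at^4 + bt^2 + ct + d$ with $a,b,c,d \in K$.
   Context: For $y\in L$, the elements $\sigma_i(y)\in K$ are defined by writing the characteristic polynomial of the $K$-linear map $L\to L$, $z\mapsto yz$, as $t^6 - \sigma_1(y)t^5 + \sigma_2(y)t^4 - \sigma_3(y)t^3 + \sigma_4(y)t^2 - \sigma_5(y)t + \sigma_6(y)$. A field $K$ is a $C_1$-field if every homogeneous polynomial over $K$ of degree $d$ in more than $d$ variables has a nontrivial zero in $K$. *)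

(* Defs.v *)
From HB Require Import structures.
From mathcomp Require Import all_boot all_order all_algebra all_field.
From mathcomp Require Import mpoly.
Import passmx.

Set Implicit Arguments.
Unset Strict Implicit.
Unset Printing Implicit Defensive.

Import GRing.Theory.
Local Open Scope ring_scope.

(* The bound 0 < d is implicit in the usual definition: a nonzero constant is
   homogeneous of degree 0 and never has a zero, so no field would be C_1. *)
Definition C1_field (K : fieldType) : Prop :=
  forall (n d : nat) (p : {mpoly K[n]}),
    (0 < d)%N -> (d < n)%N -> p \is d.-homog ->
    exists v : 'I_n -> K, (exists i, v i != 0) /\ p.@[v] = 0.

Section Sigma.
Variables (K : fieldType) (L : fieldExtType K).

Definition mul_char_poly (y : L) : {poly K} :=
  char_poly (mxof (vbasis {:L}) (vbasis {:L}) (amull y)).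

(* With n = [L : K], the characteristic polynomial of z |-> y * z is
   t^n - sigma_1(y) t^(n-1) + sigma_2(y) t^(n-2) - ...; only i <= n is
   meaningful, because of the truncated subtraction. *)
Definition sigma (i : nat) (y : L) : K :=
  (-1) ^+ i * (mul_char_poly y)`_(\dim {:L} - i).

End Sigma.

(* Main.v *)
(* Case (a). Let F be a cubic subfield. It has a generator u with
   u^3 = p (u + 1), p != 0, and L = F(y) with y^2 = u^2 y + n, where
   n = n0 + n1 u + n2 u^2. The minimal polynomial of y divides the norm to K of
   t^2 + u^2 t + n; when n1 = p this sextic has no t^5 and t^3 terms, and y
   generates L as soon as n0 != n2^2. Replacing y by y + z1 u + k u^2, a linear
   equation for z1 gives n1 = p for every k in K. The condition n0 != n2^2 is
   met for k = 0 or for any k with k^2 + k != 0, since otherwise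
   t^3 - p (t + 1) would have a root in K; and if no such k is at hand, then
   p = 1 and n0 = n2^2 would force y into F.

   Case (b). The sigma_3 form restricted to a complement of K in the kernel of
   the trace is a cubic form in at least 4 variables, so it has a nontrivial
   zero y. If y has degree 3, then case (a) applies to K(y); degree 2 is
   excluded because then the trace of y is 3 times that of a separable
   quadratic element. *)
From HB Require Import structures.
Require Import Defs.
From mathcomp Require Import all_boot all_order all_algebra all_field.
From mathcomp Require Import mpoly.
From mathcomp Require Import ring zify.
Import passmx.

Set Implicit Arguments.
Unset Strict Implicit.
Unset Printing Implicit Defensive.

Import GRing.Theory.
Local Open Scope ring_scope.

(** * Arithmetic in characteristic 2 *)

Lemma natr_odd {R : pzRingType} n : 2 = 0 :> R -> n%:R = (odd n)%:R :> R.
Proof.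
move=> h2; rewrite -[in LHS](odd_double_half n) natrD -muln2 natrM h2.
by rewrite mulr0 addr0.
Qed.

Lemma oppr1_pchar2 {R : pzRingType} : 2 = 0 :> R -> - 1 = 1 :> R.
Proof. by move=> h2; apply/esym/eqP; rewrite -subr_eq0 opprK -h2. Qed.

(* [ring] rewrites an integer coefficient only by a rule with exactly that
   coefficient on the left, so reduction mod 2 needs one rule per value. *)
Ltac char2_ring_with h2 h h' :=
  lazymatch type of h2 with @eq ?R _ _ =>
    let h3 := fresh in have h3 : 3 = 1 :> R := natr_odd 3 h2;
    let h4 := fresh in have h4 : 4 = 0 :> R := natr_odd 4 h2;
    let h5 := fresh in have h5 : 5 = 1 :> R := natr_odd 5 h2;
    let h6 := fresh in have h6 : 6 = 0 :> R := natr_odd 6 h2;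
    let h7 := fresh in have h7 : 7 = 1 :> R := natr_odd 7 h2;
    let h8 := fresh in have h8 : 8 = 0 :> R := natr_odd 8 h2;
    let h9 := fresh in have h9 : 9 = 1 :> R := natr_odd 9 h2;
    let h10 := fresh in have h10 : 10 = 0 :> R := natr_odd 10 h2;
    let h12 := fresh in have h12 : 12 = 0 :> R := natr_odd 12 h2;
    let h14 := fresh in have h14 : 14 = 0 :> R := natr_odd 14 h2;
    let h16 := fresh in have h16 : 16 = 0 :> R := natr_odd 16 h2;
    let h18 := fresh in have h18 : 18 = 0 :> R := natr_odd 18 h2;
    let h20 := fresh in have h20 : 20 = 0 :> R := natr_odd 20 h2;
    let h22 := fresh in have h22 : 22 = 0 :> R := natr_odd 22 h2;
    let h24 := fresh in have h24 : 24 = 0 :> R := natr_odd 24 h2;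
    let h26 := fresh in have h26 : 26 = 0 :> R := natr_odd 26 h2;
    let h30 := fresh in have h30 : 30 = 0 :> R := natr_odd 30 h2;
    let hN := fresh in have hN : - 1 = 1 :> R := oppr1_pchar2 h2;
    ring: h2 hN h3 h4 h5 h6 h7 h8 h9 h10 h12 h14
      h16 h18 h20 h22 h24 h26 h30 h h'
  end.
Tactic Notation "char2_ring" constr(h2) := char2_ring_with h2 h2 h2.
Tactic Notation "char2_ring" constr(h2) constr(h) := char2_ring_with h2 h h2.
Tactic Notation "char2_ring" constr(h2) constr(h) constr(h') :=
  char2_ring_with h2 h h'.

(** * Homogeneity of the characteristic polynomial of a matrix of linear forms *)

Section HomogeneousCharPoly.
Variables (R : comNzRingType) (n : nat).
Implicit Types (p q : {poly {mpoly R[n]}}) (c : {mpoly R[n]}).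

(** Homogeneity of total degree d in the n variables together with the polynomial variable, the
    latter also counted with weight 1. *)
Definition homog_poly d p :=
  forall i, if (i <= d)%N then p`_i \is (d - i).-homog else p`_i == 0.

Lemma homog_polyC c : c \is 0.-homog -> homog_poly 0 c%:P.
Proof. by move=> h [|i]; rewrite coefC /= ?subnn. Qed.

Lemma homog_polyD d p q :
  homog_poly d p -> homog_poly d q -> homog_poly d (p + q).
Proof.
move=> hp hq i; move: (hp i) (hq i); rewrite coefD.
by case: leqP => _ => [pi qi|/eqP-> /eqP->]; [rewrite rpredD | rewrite addr0].
Qed.

Lemma homog_polyM d e p q :
  homog_poly d p -> homog_poly e q -> homog_poly (d + e) (p * q).
Proof.
move=> hp hq i; rewrite coefM; case: leqP => [lei|lti].
  apply: rpred_sum => j _; move: (hp j) (hq (i - j)%N).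
  case: (leqP j d) => [ljd pj|_ /eqP->]; last by rewrite mul0r rpred0.
  case: (leqP (i - j) e) => [lije qj|_ /eqP->]; last by rewrite mulr0 rpred0.
  suff -> : (d + e - i)%N = (d - j + (e - (i - j)))%N by apply: dhomogM.
  have := ltn_ord j; rewrite ltnS => lji.
  rewrite -{1}(subnKC lji) subnDA -addnBAC // addnBA //.
rewrite big1 // => j _; move: (hp j) (hq (i - j)%N).
case: (leqP j d) => [ljd _|_ /eqP->]; last by rewrite mul0r.
case: (leqP (i - j) e) => [lije _|_ /eqP->]; last by rewrite mulr0.
have := ltn_ord j; rewrite ltnS => lji.
by have := leq_add ljd lije; rewrite subnKC // leqNgt lti.
Qed.

Lemma homog_poly_prod m (F : 'I_m -> {poly {mpoly R[n]}}) :
  (forall i, homog_poly 1 (F i)) -> homog_poly m (\prod_i F i).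
Proof.
elim: m F => [|m IH] F hF.
  by rewrite big_ord0 -polyC1; apply/homog_polyC/dhomog1.
by rewrite big_ord_recl; apply: (@homog_polyM 1 m) => //; apply: IH.
Qed.

(** The entries of t - A are linear forms once t has weight 1, so every term of the Leibniz
    expansion of the determinant has total degree m. *)
Lemma char_poly_homog m (A : 'M[{mpoly R[n]}]_m) :
  (forall i j, A i j \is 1.-homog) -> homog_poly m (char_poly A).
Proof.
move=> hA; rewrite /char_poly /determinant.
elim/big_rec: _ => [|s p _ hp].
  by move=> i; rewrite coef0 rpred0 eqxx if_same.
apply: homog_polyD hp; rewrite -signr_odd; apply: (@homog_polyM 0 m).
  by case: odd; rewrite ?expr1 ?expr0 -?polyC1 -?polyCN;
    apply: homog_polyC; rewrite ?dhomogN dhomog1.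
apply: homog_poly_prod => i [|[|j]]; rewrite !mxE coefB coefMn coefX coefC /=.
- by rewrite mul0rn sub0r rpredN; apply: hA.
- by rewrite subr0 subnn; case: (_ == _); [apply: dhomog1 | apply: rpred0].
- by rewrite mul0rn subr0.
Qed.

End HomogeneousCharPoly.

(** * Characteristic polynomials of matrices killed by a quadratic polynomial *)

Lemma char_poly_dvd_quadratic (K : fieldType) n (A : 'M[K]_n) a b :
    A *m A = a *: A + b%:M ->
  char_poly A %| ('X^2 - a *: 'X - b%:P) ^+ n.
Proof.
move=> A2; pose B := map_mx polyC A.
have B2 : B *m B = a%:P *: B + b%:P%:M.
  by rewrite -map_mxM A2 map_mxD map_mxZ map_scalar_mx.
(* m(t) - m(A) factors as (t - A) (t + A - a). *)
rewrite -det_scalar (_ : _%:M = char_poly_mx A *m ('X%:M + B - a%:P%:M)).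
  by rewrite det_mulmx dvdp_mulr.
rewrite /char_poly_mx -/B mulmxBl mul_scalar_mx mulmxBr mulmxDr B2.
rewrite !mul_mx_scalar; apply/matrixP=> i j; rewrite !mxE -mul_polyC.
by case: (i == j); rewrite ?mulr1n ?mulr0n; ring.
Qed.

Lemma monic_dvd_irredp_exp (K : fieldType) (m q : {poly K}) n :
    irreducible_poly m -> m \is monic -> q \is monic -> q %| m ^+ n ->
  exists j, q = m ^+ j.
Proof.
move=> im mm; elim: n q => [|n IH] q mq.
  rewrite expr0 dvdp1 size_poly_eq1 => q1; exists 0%N; rewrite expr0.
  by apply/eqP; rewrite -eqp_monic ?monic1.
move=> dq; have [/dvdpP[r qE]|nmq] := boolP (m %| q).
  have mr : r \is monic by rewrite qE (monicMr _ mm) in mq.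
  have [|j rE] := IH r mr; last by exists j.+1; rewrite qE rE exprSr.
  by move: dq; rewrite qE exprSr dvdp_mul2r // irredp_neq0.
apply: (IH q mq); move: dq; rewrite exprS Gauss_dvdpr //.
by rewrite coprimep_sym irreducible_poly_coprime.
Qed.

(* The sextic is the norm to K of t^2 + u^2 t + (n0 + p u + n2 u^2), for u a
   root of t^3 - p (t + 1): its t^3 coefficient vanishes because the
   coefficient of u in the constant term is p. *)
Lemma norm_quadratic (R : comNzRingType) (u p y n0 n2 : R) :
    2 = 0 :> R -> u ^+ 3 = p * (u + 1) ->
    y ^+ 2 = u ^+ 2 * y + (n0 + p * u + n2 * u ^+ 2) ->
  y ^+ 6 + (n0 + p ^+ 2) * y ^+ 4
    + (n0 ^+ 2 + p ^+ 2 * n2 ^+ 2 + n0 * p ^+ 2) * y ^+ 2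
    + p ^+ 2 * (n0 + n2 ^+ 2) * y
    + (n0 ^+ 3 + n0 * (p ^+ 3 + p ^+ 2 * n2 ^+ 2 + p ^+ 2 * n2)
       + p ^+ 4 + p ^+ 3 * n2 ^+ 2 + p ^+ 2 * n2 ^+ 3) = 0.
Proof. by move=> h2 hu hy; char2_ring h2 hu hy. Qed.

(** * Coordinates in simple extensions of K *)

Section Extension.
Variables (K : fieldType) (L : fieldExtType K).
Implicit Types (x y u v : L) (a b c p : K) (E F : {subfield L}).

Lemma adjoin_degree1E y : adjoin_degree 1%VS y = \dim <<1; y>>%VS.
Proof. by rewrite dim_Fadjoin dimv1 muln1. Qed.

Lemma Fadjoin_horner_eq0 y (q : {poly K}) :
    (size q <= \dim <<1; y>>)%N -> (map_poly (in_alg L) q).[y] = 0 -> q = 0.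
Proof.
move=> szq qy0; apply/eqP; rewrite -(map_poly_eq0 (in_alg L)).
rewrite -(@root_small_adjoin_poly _ _ 1%AS y) ?alg_polyOver //.
  exact/rootP.
by rewrite size_map_poly adjoin_degree1E.
Qed.

Lemma Fadjoin_hornerP y v :
    v \in <<1; y>>%VS ->
  exists2 q : {poly K}, (size q <= \dim <<1; y>>)%N
    & v = (map_poly (in_alg L) q).[y].
Proof.
move=> /Fadjoin_poly_eq vE.
have /polyOver1P[q Dq] := Fadjoin_polyOver 1%VS y v.
exists q; last by rewrite -Dq vE.
by rewrite -(size_map_poly (in_alg L)) -Dq -adjoin_degree1E size_Fadjoin_poly.
Qed.

Lemma pow_dim_horner y :
  exists2 q : {poly K}, (size q <= \dim <<1; y>>)%N
    & y ^+ (\dim <<1; y>>) = (map_poly (in_alg L) q).[y].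
Proof. by apply: Fadjoin_hornerP; rewrite rpredX ?memv_adjoin. Qed.

Lemma horner_alg_size2 (q : {poly K}) y :
  (size q <= 2)%N ->
  (map_poly (in_alg L) q).[y] = in_alg L q`_0 + in_alg L q`_1 * y.
Proof.
move=> szq; rewrite (@horner_coef_wide _ 2) ?size_map_poly //.
by rewrite !big_ord_recr big_ord0 /= !coef_map /=; ring.
Qed.

Lemma horner_alg_size3 (q : {poly K}) y :
  (size q <= 3)%N ->
  (map_poly (in_alg L) q).[y] =
    in_alg L q`_0 + in_alg L q`_1 * y + in_alg L q`_2 * y ^+ 2.
Proof.
move=> szq; rewrite (@horner_coef_wide _ 3) ?size_map_poly //.
by rewrite !big_ord_recr big_ord0 /= !coef_map /=; ring.
Qed.

Lemma Fadjoin3P u v :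
    \dim <<1; u>>%VS = 3%N -> v \in <<1; u>>%VS ->
  exists a b c, v = in_alg L a + in_alg L b * u + in_alg L c * u ^+ 2.
Proof.
move=> du /Fadjoin_hornerP[q]; rewrite du => /horner_alg_size3-> ->.
by exists q`_0, q`_1, q`_2.
Qed.

Lemma Fadjoin3_free u a b c :
    \dim <<1; u>>%VS = 3%N ->
    in_alg L a + in_alg L b * u + in_alg L c * u ^+ 2 = 0 ->
  [/\ a = 0, b = 0 & c = 0].
Proof.
move=> du h; pose q := Poly [:: a; b; c].
have szq: (size q <= 3)%N by apply: size_Poly.
have q0: q = 0.
  by apply: (@Fadjoin_horner_eq0 u); rewrite ?du //
    horner_alg_size3 // !coef_Poly.
by split; [have := coef_Poly [:: a; b; c] 0 | have := coef_Poly [:: a; b; c] 1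
  | have := coef_Poly [:: a; b; c] 2]; rewrite -/q q0 coef0.
Qed.

Lemma cubic_Fadjoin F u : \dim F = 3%N -> u \in F -> u \notin 1%VS ->
  <<1; u>>%VS = F /\ \dim <<1; u>>%VS = 3%N.
Proof.
move=> dF Fu nu.
have sF : (<<1; u>> <= F)%VS by rewrite sub_adjoin1v.
have d3 : \dim <<1; u>>%VS = 3%N.
  apply/prime_nt_dvdP; rewrite // -?dF ?field_dimS // -adjoin_degree1E.
  by rewrite adjoin_deg_eq1.
by split=> //; apply/eqP; rewrite eqEdim sF d3 dF.
Qed.

Lemma in_alg1 a : in_alg L a \in 1%VS.
Proof. exact/rpredZ/mem1v. Qed.

Lemma in_algP v : v \in 1%VS -> exists a, v = in_alg L a.
Proof. by case/vlineP=> a ->; exists a. Qed.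

(** * Normalised generators of cubic subfields in characteristic 2 *)

Hypothesis charK : 2%N \in [pchar K].

Let h2K : 2 = 0 :> K := pcharf0 charK.
Let h2L : 2 = 0 :> L.
Proof. by rewrite -(rmorph_nat (in_alg L)) h2K rmorph0. Qed.

Lemma cubic_generator F : \dim F = 3%N ->
  exists u p, [/\ u \in F, u \notin 1%VS, p != 0
    & u ^+ 3 = in_alg L p * (u + 1)].
Proof.
move=> dF.
have [x Fx nx] : exists2 x, x \in F & x \notin 1%VS.
  by apply/subvPn; apply/negP=> /dimvS; rewrite dF dimv1.
have [_ dx] := cubic_Fadjoin dF Fx nx.
have [q] := pow_dim_horner x; rewrite dx => szq; rewrite horner_alg_size3 //.
set c := q`_0; set b := q`_1; set a := q`_2 => x3.
(* A cubic without square term and with nonzero linear coefficient is enough, because a rescaling of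
   u then makes the two remaining coefficients equal. *)
suff [u [b' [c' [Fu nu nb u3]]]] : exists u b' c', [/\ u \in F, u \notin 1%VS,
    b' != 0 & u ^+ 3 = in_alg L b' * u + in_alg L c'].
  have [_ du] := cubic_Fadjoin dF Fu nu.
  have nc : c' != 0.
    apply: contraNneq nu => c0; move: u3; rewrite c0 rmorph0 addr0.
    have [->|u0] := eqVneq u 0; first by rewrite rpred0.
    rewrite exprSr => /(mulIf u0) u2.
    have [|_ _ /eqP] := @Fadjoin3_free u b' 0 (-1) du.
      by rewrite u2; ring.
    by rewrite oppr_eq0 oner_eq0.
  (* With s = b'/c', (s u)^3 = s^2 b' (s u) + s^3 c', and s^2 b' = s^3 c' = b'^3 / c'^2. *)
  exists (in_alg L (b' / c') * u), (b' ^+ 3 / c' ^+ 2).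
  have nd : b' / c' != 0 by rewrite mulf_neq0 ?invr_eq0.
  split.
  - by rewrite rpredM // (subvP (sub1v F)) ?in_alg1.
  - apply: contra nu => h.
    rewrite -[u](mulKf (_ : in_alg L (b' / c') != 0)) ?fmorph_eq0 //.
    by rewrite rpredM // rpredV in_alg1.
  - by rewrite mulf_neq0 ?invr_eq0 ?expf_neq0.
  - rewrite exprMn u3 !(rmorphM, rmorphXn, fmorphV) /= -!in_algE.
    have : in_alg L c' != 0 by rewrite (fmorph_eq0 (in_alg L)).
    by move: (in_alg L c') (in_alg L b') => C B nC; field.
(* Since 3 = 1, translating x by a removes the square term; the linear coefficient becomes b + a^2
   and the constant c + a b. *)
have [e0|ne] := eqVneq (b + a ^+ 2) 0; last first.
  exists (x + in_alg L a), (b + a ^+ 2), (c + a * b); split=> //.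
  - by rewrite rpredD // (subvP (sub1v F)) ?in_alg1.
  - by apply: contra nx => h; rewrite -[x](addrK (in_alg L a)) rpredB ?in_alg1.
  - by char2_ring h2L x3.
set y := x + in_alg L a; set q0 := c + a * b.
have ny : y \notin 1%VS.
  by apply: contra nx => h; rewrite -[x](addrK (in_alg L a)) rpredB ?in_alg1.
have Fy : y \in F by rewrite rpredD // (subvP (sub1v F)) ?in_alg1.
have y3 : y ^+ 3 = in_alg L q0.
  transitivity (in_alg L (b + a ^+ 2) * y + in_alg L q0); last first.
    by rewrite e0 rmorph0 mul0r add0r.
  by rewrite /y /q0; char2_ring h2L x3.
have [_ dy] := cubic_Fadjoin dF Fy ny.
have nq0 : q0 != 0.
  apply: contraNneq ny => q00; move/eqP: y3; rewrite q00 rmorph0 expf_eq0 /=.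
  by move/eqP->; rewrite rpred0.
(* In the pure cubic case y^3 = q0, one has (y + y^2)^3 = y^3 + y^4 + y^5 + y^6 = q0 (y + y^2) + q0
   + q0^2. *)
exists (y + y ^+ 2), q0, (q0 * (1 + q0)); split=> //.
- by rewrite rpredD ?rpredX.
- apply/negP=> /in_algP[k] h.
  have [|_ /eqP] := @Fadjoin3_free y k (-1) (-1) dy.
    by rewrite -h; ring.
  by rewrite oppr_eq0 oner_eq0.
- by char2_ring h2L y3.
Qed.

(** For a root a in K, the cubic at u factors as (u - a) (u^2 + a u + a^2 + p), so u would have
    degree at most 2 over K. *)
Lemma no_cubic_root u p a :
    \dim <<1; u>>%VS = 3%N -> u ^+ 3 = in_alg L p * (u + 1) ->
  a ^+ 3 != p * (a + 1).
Proof.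
move=> du u3; apply/eqP=> a3.
have nu : u - in_alg L a != 0.
  apply/eqP=> ua.
  have [|_ /eqP] := @Fadjoin3_free u (- a) 1 0 du.
    by rewrite rmorphN rmorph1 rmorph0 mul1r mul0r addr0 addrC.
  by rewrite oner_eq0.
have [|_ _ /eqP] := @Fadjoin3_free u (a ^+ 2 + p) a 1 du; last first.
  by rewrite oner_eq0.
apply: (mulfI nu).
have a3L : in_alg L a ^+ 3 = in_alg L p * (in_alg L a + 1).
  by rewrite -rmorphXn a3 rmorphM rmorphD rmorph1.
char2_ring h2L u3 a3L.
Qed.

Lemma notin_linear_eq0 F y (s t : L) : y \notin F -> s \in F -> t \in F ->
  s + t * y = 0 -> s = 0 /\ t = 0.
Proof.
move=> nFy Fs Ft st0; suff t0 : t = 0 by rewrite t0 mul0r addr0 in st0.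
apply: contraNeq nFy => nt; suff -> : y = - s / t by rewrite rpred_div ?rpredN.
apply: (mulIf nt); rewrite mulfVK //.
by apply/eqP; rewrite -addr_eq0 addrC mulrC st0.
Qed.

(** * Quadratic generators over a cubic subfield *)

Hypothesis degL : \dim {:L} = 6%N.

(* If y had degree 3, then y^3 in K + K y + K y^2 would force n0 = n2^2, by
   comparing coordinates in the basis u^i y^j of L. *)
Lemma sextic_generator u p y n0 n2 :
    \dim <<1; u>>%VS = 3%N -> u ^+ 3 = in_alg L p * (u + 1) ->
    y \notin <<1; u>>%VS ->
    y ^+ 2 = u ^+ 2 * y
      + (in_alg L n0 + in_alg L p * u + in_alg L n2 * u ^+ 2) ->
    n0 != n2 ^+ 2 ->
  <<1; y>>%VS = {:L}%VS.
Proof.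
move=> du u3 nFy y2 nn; set F := <<1; u>>%AS in nFy.
have FK a : in_alg L a \in F by rewrite (subvP (sub1v F)) ?in_alg1.
have Fu : u \in F := memv_adjoin _ _.
have dd : (\dim <<1; y>> %| 6)%N by rewrite -degL field_dimS ?subvf.
have [q] := pow_dim_horner y.
have : \dim <<1; y>>%VS \in divisors 6 by rewrite -dvdn_divisors.
rewrite !inE => /or4P[] /eqP d; rewrite d => szq yq.
- case/negP: nFy; rewrite (subvP (sub1v F)) // -adjoin_deg_eq1.
  by rewrite adjoin_degree1E d.
(* Degree 2: comparing the coefficients of y in the two expressions of y^2 over F puts u^2 in K. *)
- move: yq; rewrite horner_alg_size2 // y2 => yq.
  set n := in_alg L n0 + _ + _ in yq.
  have Fn : n \in F by rewrite !(rpredD, rpredM, rpredX).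
  have [|||_ h] := @notin_linear_eq0 F y
    (n - in_alg L q`_0) (u ^+ 2 - in_alg L q`_1) nFy.
  + by rewrite rpredB.
  + by rewrite rpredB ?rpredX.
  + by rewrite -(subrr (in_alg L q`_0 + in_alg L q`_1 * y)) -{1}yq; ring.
  have [|_ _ /eqP] :=
    @Fadjoin3_free u (- q`_1) 0 1 du; last by rewrite oner_eq0.
  by rewrite -h; ring.
- move: yq; rewrite horner_alg_size3 //; move: (q`_0) (q`_1) (q`_2) => c b a yq.
  set n := in_alg L n0 + _ + _ in y2.
  have Fn : n \in F by rewrite !(rpredD, rpredM, rpredX).
  have [|||hs ht] := @notin_linear_eq0 F y
     (u ^+ 2 * n + in_alg L a * n + in_alg L c)
     (u ^+ 4 + n + in_alg L a * u ^+ 2 + in_alg L b) nFy.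
  + by rewrite !(rpredD, rpredM, rpredX).
  + by rewrite !(rpredD, rpredM, rpredX).
  + have -> : in_alg L c = y ^+ 3 + in_alg L b * y + in_alg L a * y ^+ 2.
      by rewrite yq; char2_ring h2L.
    by char2_ring h2L y2.
  (* The u^2 coordinate of [ht] gives a = n2 + p; substituted in that of [hs], it gives n0 =
     n2^2. *)
  have [|e0 _ /eqP e2] := @Fadjoin3_free u (n0 + b) 0 (n2 + p + a) du.
    by rewrite -ht /n; char2_ring h2L u3.
  have [|_ _ e2'] := @Fadjoin3_free u (p ^+ 2 + a * n0 + c)
     (p * n2 + p ^+ 2 + a * p) (n0 + p * n2 + a * n2) du.
    by rewrite -hs /n; char2_ring h2L u3.
  case/eqP: nn; move: e2; rewrite addrC => /eqP e2.
  have ea : a = n2 + p by rewrite -[LHS]addr0 -e2; char2_ring h2K.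
  by rewrite -[LHS]addr0 -e2' ea; char2_ring h2K.
- by apply/eqP; rewrite eqEdim subvf d degL.
Qed.

(** Any x outside F satisfies x^2 + m1 x + m0 = 0 over F. Separability forces m1 != 0, because the
    derivative of this quadratic is the constant m1 in characteristic 2; scaling x by u^2 / m1 turns
    the linear coefficient into u^2. *)
Lemma artin_schreier F u : separable 1%VS {:L} -> \dim F = 3%N ->
    u \in F -> u != 0 ->
  exists2 y, y \notin F & y ^+ 2 + u ^+ 2 * y \in F.
Proof.
move=> sepL dF Fu nu.
have [x _ nx] : exists2 x, x \in fullv & x \notin F.
  by apply/subvPn; apply/negP=> /dimvS; rewrite dF degL.
have d2 : adjoin_degree F x = 2%N.
  have /(field_dimS) : (<<F; x>> <= {:L})%VS by apply: subvf.
  rewrite degL dim_Fadjoin dF -[6%N]/(2 * 3)%N dvdn_pmul2r // => dd.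
  by apply/prime_nt_dvdP => //; rewrite adjoin_deg_eq1.
have szm : size (minPoly F x) = 3%N by rewrite size_minPoly d2.
have m2 : (minPoly F x)`_2 = 1.
  by have /monicP := monic_minPoly F x; rewrite lead_coefE szm.
have /polyOverP Fm := minPolyOver F x.
have := minPolyxx F x; rewrite horner_coef szm !big_ord_recr big_ord0 /= m2.
set m0 := _`_0; set m1 := _`_1 => mx.
have nm1 : m1 != 0.
  have /(separable_elementS (sub1v F)) : separable_element 1 x.
    by apply: (separableP sepL); rewrite memvf.
  rewrite separable_nz_der; apply: contraNneq => m10.
  apply/eqP/polyP=> i; rewrite coef0 coef_deriv.
  case: i => [|[|i]]; first by rewrite -/m1 m10 mul0rn.
    by rewrite m2 h2L.
  by rewrite nth_default ?mul0rn // szm.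
exists (u ^+ 2 / m1 * x).
  apply: contra nx => h.
  have nd : u ^+ 2 / m1 != 0 by rewrite mulf_neq0 ?expf_neq0 ?invr_eq0.
  by rewrite -[x](mulKf nd) rpredM // rpredV rpred_div ?rpredX ?Fm.
have -> : (u ^+ 2 / m1 * x) ^+ 2 + u ^+ 2 * (u ^+ 2 / m1 * x)
    = (u ^+ 2 / m1) ^+ 2 * (- m0).
  have -> : - m0 = x ^+ 2 + m1 * x.
    by rewrite -[LHS]addr0 -mx; ring.
  by field.
by rewrite rpredM ?rpredX ?rpredN ?rpred_div ?rpredX ?Fm.
Qed.

Lemma sextic_data F : separable 1%VS {:L} -> \dim F = 3%N ->
  exists u p y n0 n2, [/\ \dim <<1; u>>%VS = 3%N,
    u ^+ 3 = in_alg L p * (u + 1), y \notin <<1; u>>%VS,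
    y ^+ 2 = u ^+ 2 * y
      + (in_alg L n0 + in_alg L p * u + in_alg L n2 * u ^+ 2) &
    n0 != n2 ^+ 2].
Proof.
move=> sepL dF.
have [u [p [Fu nu np u3]]] := cubic_generator dF.
have [uF du] := cubic_Fadjoin dF Fu nu.
have u0 : u != 0 by apply: contraNneq nu => ->; rewrite rpred0.
have [y0 nFy0] := artin_schreier sepL dF Fu u0.
rewrite -uF in nFy0 *; case/(Fadjoin3P du) => N0 [N1 [N2 y0E]].
have FK a : in_alg L a \in <<1; u>>%AS.
  by rewrite (subvP (sub1v _)) ?in_alg1.
have Fu' : u \in <<1; u>>%AS by rewrite memv_adjoin.
(* These come from y = y0 + z1 u + k u^2 and u^4 = p (u^2 + u): the u coordinate of y^2 + u^2 y is
   N1 + p (z1 + k^2 + k), which [z1 k] makes equal to p, and [n0 k], [n2 k] are the other two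
   coordinates. *)
pose z1 k := N1 / p + 1 + (k ^+ 2 + k).
pose n0 k := N0 + p * z1 k.
pose n2 k := N2 + z1 k ^+ 2 + p * (k ^+ 2 + k).
suff [k nk] : exists k, n0 k != n2 k ^+ 2.
  exists u, p, (y0 + (in_alg L (z1 k) * u + in_alg L k * u ^+ 2)).
  exists (n0 k), (n2 k).
  split=> //.
    apply: contra nFy0 => h.
    rewrite -[y0](addrK (in_alg L (z1 k) * u + in_alg L k * u ^+ 2)).
    by rewrite rpredB // !(rpredD, rpredM, rpredX).
  have N1E : N1 = p * (z1 k + 1 + k ^+ 2 + k).
    rewrite /z1 -[LHS](mulfVK np) mulrC; congr (_ * _).
    by move: (N1 / p) => Z; char2_ring h2K.
  have y0E' : y0 ^+ 2 = u ^+ 2 * y0 +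
     (in_alg L N0 + in_alg L N1 * u + in_alg L N2 * u ^+ 2).
    by rewrite -y0E; char2_ring h2L.
  by rewrite /n0 /n2; rewrite N1E in y0E'; char2_ring h2L y0E' u3.
have [n00|] := eqVneq (n0 0) (n2 0 ^+ 2); last by exists 0.
(* Put r = k^2 + k. If equality holds both at 0 and at k, their difference divided by r is r^3 = p^2
   r + p, and then r (r + 1 + p) is a root of t^3 - p (t + 1) in K. *)
have shift k : k ^+ 2 + k != 0 -> n0 k != n2 k ^+ 2.
  move=> nk; apply/eqP=> nkE.
  pose x := (k ^+ 2 + k) * (k ^+ 2 + k + 1 + p).
  have /eqP[] := @no_cubic_root u p x du u3.
  have k3 : (k ^+ 2 + k) ^+ 3 = p ^+ 2 * (k ^+ 2 + k) + p.
    apply: (mulfI nk).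
    have n0k : n0 k = n0 0 + p * (k ^+ 2 + k) by rewrite /n0 /z1; ring.
    have n2k : n2 k = n2 0 + (k ^+ 2 + k) ^+ 2 + p * (k ^+ 2 + k).
      by rewrite /n2 /z1; move: (N1 / p) (k ^+ 2 + k) => Z kap; char2_ring h2K.
    rewrite n0k n2k n00 in nkE; move: (k ^+ 2 + k) nkE => kap nkE.
    have e : n2 0 ^+ 2 + p * kap + (n2 0 + kap ^+ 2 + p * kap) ^+ 2 = 0.
      by rewrite nkE; char2_ring h2K.
    by rewrite -[LHS]addr0 -e; char2_ring h2K.
  by rewrite /x; move: (k ^+ 2 + k) k3 => kap k3; char2_ring h2K k3.
(* The coefficients themselves serve as candidates for k: if none of them works, all are idempotent,
   hence 0 or 1, and p = 1. *)
have [|/shift] := eqVneq (p ^+ 2 + p) 0; last by exists p.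
have [|/shift] := eqVneq (N0 ^+ 2 + N0) 0; last by exists N0.
have [|/shift] := eqVneq (N1 ^+ 2 + N1) 0; last by exists N1.
have [|/shift] := eqVneq (N2 ^+ 2 + N2) 0; last by exists N2.
have idem (k : K) : k ^+ 2 + k = 0 -> k ^+ 2 = k.
  by move=> k0; rewrite -[RHS]add0r -k0; char2_ring h2K.
move=> /idem N22 /idem N12 /idem N02 /idem p2.
have p1 : p = 1 by apply: (mulfI np); rewrite -expr2 p2 mulr1.
have N20 : N2 = N0.
  have e : n0 0 + n2 0 ^+ 2 = 0 by rewrite n00; char2_ring h2K.
  rewrite -[LHS]addr0 -e /n0 /n2 /z1 p1 invr1.
  by char2_ring h2K N12 N22.
(* All the coordinates now lie in F_2, and y0^2 + u^2 y0 = z^2 + u^2 z. *)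
case/negP: nFy0; pose z := in_alg L (N0 + N1) + in_alg L N1 * u.
have Fz : z \in <<1; u>>%AS by rewrite !(rpredD, rpredM).
have : (y0 + z) * (y0 + z + u ^+ 2) = 0.
  have N02L : in_alg L N0 ^+ 2 = in_alg L N0 by rewrite -rmorphXn N02.
  have N12L : in_alg L N1 ^+ 2 = in_alg L N1 by rewrite -rmorphXn N12.
  transitivity (y0 ^+ 2 + u ^+ 2 * y0 + (z ^+ 2 + u ^+ 2 * z)).
    by char2_ring h2L.
  rewrite y0E /z N20; rewrite p1 rmorph1 mul1r in u3.
  transitivity (in_alg L N0 + in_alg L N0 ^+ 2
    + (in_alg L N1 + in_alg L N1 ^+ 2) * (1 + u ^+ 2)).
    by char2_ring h2L u3.
  by rewrite N02L N12L; char2_ring h2L.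
move/eqP; rewrite mulf_eq0 => /orP[] /eqP h.
  by rewrite -[y0](addrK z) h rpredB ?rpred0.
by rewrite -[y0](addrK (z + u ^+ 2)) addrA h rpredB ?rpred0 // rpredD ?rpredX.
Qed.

(** * Characteristic polynomial of multiplication by an element; end of case (a) *)

Lemma mxof_amull_row y (i : 'I_(\dim {:L})) :
  y * (vbasis {:L})`_i =
    \sum_j in_alg L (mxof (vbasis {:L}) (vbasis {:L}) (amull y) i j)
      * (vbasis {:L})`_j.
Proof.
rewrite [LHS](coord_vbasis (memvf _)); apply: eq_bigr => j _.
by rewrite mxE /= mxE vecof_delta lfunE mulr_algl.
Qed.

(** Over L, the row of basis vectors is an eigenvector, with eigenvalue y, of the transposed
    multiplication matrix. *)
Lemma root_mul_char_poly y : root (map_poly (in_alg L) (mul_char_poly y)) y.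
Proof.
rewrite map_char_poly; set A := map_mx _ _.
have -> : char_poly A = char_poly A^T.
  rewrite /char_poly -det_tr; congr (\det _); apply/matrixP=> i j.
  by rewrite !mxE eq_sym.
rewrite -eigenvalue_root_char; apply/eigenvalueP.
exists (\row_i (vbasis {:L})`_i).
  apply/rowP=> i; rewrite !mxE mxof_amull_row; apply: eq_bigr => j _.
  by rewrite !mxE mulrC.
apply/eqP=> v0; have : (1 : L) = 0.
  rewrite [LHS](coord_vbasis (memvf _)) big1 // => i _.
  by have := congr1 (fun w : 'rV_ _ => w 0 i) v0; rewrite !mxE => ->;
    rewrite scaler0.
by apply/eqP/oner_neq0.
Qed.

Lemma minPoly_of_root y (q : {poly K}) :
    q \is monic -> size q = (\dim <<1; y>>).+1 ->
    root (map_poly (in_alg L) q) y ->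
  minPoly 1%VS y = map_poly (in_alg L) q.
Proof.
move=> mq szq qy; apply/eqP; rewrite -eqp_monic ?monic_minPoly ?map_monic //.
rewrite -dvdp_size_eqp ?(@minPoly_dvdp _ _ 1%AS) ?alg_polyOver //.
by rewrite size_minPoly adjoin_degree1E size_map_poly szq.
Qed.

Lemma minPoly_mul_char_poly y : <<1; y>>%VS = {:L}%VS ->
  minPoly 1%VS y = map_poly (in_alg L) (mul_char_poly y).
Proof.
move=> gy; apply: minPoly_of_root; first exact: char_poly_monic.
  by rewrite gy size_char_poly.
exact: root_mul_char_poly.
Qed.

Lemma size_sextic a b c p :
  size ('X^6 + a *: 'X^4 + b *: 'X^2 + c *: 'X + p%:P) = 7%N /\
  'X^6 + a *: 'X^4 + b *: 'X^2 + c *: 'X + p%:P \is monic.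
Proof.
set r := a *: 'X^4 + b *: 'X^2 + c *: 'X + p%:P.
have -> : 'X^6 + a *: 'X^4 + b *: 'X^2 + c *: 'X + p%:P = 'X^6 + r.
  by rewrite /r !addrA.
have szr : (size r < size ('X^6 : {poly K}))%N.
  rewrite size_polyXn ltnS; apply/leq_sizeP=> i lti.
  rewrite !(coefD, coefZ, coefXn, coefX, coefC).
  by case: i lti => [|[|[|[|[|[|i]]]]]] //= _; rewrite !mulr0 !addr0.
by rewrite monicE lead_coefDl // lead_coefXn eqxx size_polyDl // size_polyXn.
Qed.

Lemma horner_sextic a b c p y :
  (map_poly (in_alg L)
     ('X^6 + a *: 'X^4 + b *: 'X^2 + c *: 'X + p%:P)).[y] =
  y ^+ 6 + in_alg L a * y ^+ 4 + in_alg L b * y ^+ 2 + in_alg L c * y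
    + in_alg L p.
Proof.
rewrite !rmorphD /= !map_polyZ /= !map_polyXn map_polyX map_polyC /=.
by rewrite !(hornerD, hornerZ, hornerXn, hornerX, hornerC).
Qed.

Lemma sigma13_minPoly y : <<1; y>>%VS = {:L}%VS ->
  (sigma 1 y = 0 /\ sigma 3 y = 0) <->
  exists a b c d : K,
    minPoly 1%VS y =
      map_poly (in_alg L)
        ('X^6 + a *: 'X^4 + b *: 'X^2 + c *: 'X + d%:P).
Proof.
move=> gy; rewrite minPoly_mul_char_poly // /sigma degL /=.
set q := mul_char_poly y; split=> [[q5 q3] | [a [b [c [d /map_poly_inj->]]]]].
  have sq : size q = 7%N by rewrite size_char_poly degL.
  have q6 : q`_6 = 1.
    by have := char_poly_monic (mxof (vbasis {:L}) (vbasis {:L}) (amull y));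
      rewrite monicE lead_coefE -/(mul_char_poly y) -/q sq => /eqP.
  exists q`_4, q`_2, q`_1, q`_0; congr map_poly; apply/polyP=> i.
  rewrite !(coefD, coefZ, coefXn, coefX, coefC).
  move/eqP: q5; move/eqP: q3;
    rewrite !mulf_eq0 !signr_eq0 /= => /eqP q3 /eqP q5.
  case: i => [|[|[|[|[|[|[|i]]]]]]] /=;
    rewrite ?q5 ?q3 ?q6 ?mulr0 ?mulr1 ?addr0 ?add0r //.
  by rewrite nth_default // sq.
by rewrite !(coefD, coefZ, coefXn, coefX, coefC) /= !(mulr0, addr0).
Qed.

Lemma exists_of_cubic_subfield F : separable 1%VS {:L} -> \dim F = 3%N ->
  exists y, [/\ <<1%VS; y>>%VS = {:L}%VS, sigma 1 y = 0 & sigma 3 y = 0].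
Proof.
move=> sepL dF.
have [u [p [y [n0 [n2 [du u3 nFy y2 nn]]]]]] := sextic_data sepL dF.
have gy := sextic_generator du u3 nFy y2 nn.
have [|s1 s3] := (sigma13_minPoly gy).2; last by exists y.
(* The coefficients of the sextic in [norm_quadratic]: it is monic of degree 6 = [K(y) : K] and
   vanishes at y, so it is the minimal polynomial. *)
pose a := n0 + p ^+ 2.
pose b := n0 ^+ 2 + p ^+ 2 * n2 ^+ 2 + n0 * p ^+ 2.
pose c := p ^+ 2 * (n0 + n2 ^+ 2).
pose d := n0 ^+ 3 + n0 * (p ^+ 3 + p ^+ 2 * n2 ^+ 2 + p ^+ 2 * n2)
       + p ^+ 4 + p ^+ 3 * n2 ^+ 2 + p ^+ 2 * n2 ^+ 3.
exists a, b, c, d; have [sz mon] := size_sextic a b c d.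
apply: minPoly_of_root; rewrite // ?gy ?degL //; apply/rootP.
by rewrite horner_sextic -(norm_quadratic h2L u3 y2) /a /b /c /d; ring.
Qed.

(** * The trace form and case (b) *)

Lemma sigma1_trace y :
  sigma 1 y = \tr (mxof (vbasis {:L}) (vbasis {:L}) (amull y)).
Proof.
rewrite /sigma subn1 /mul_char_poly char_poly_trace ?adim_gt0 //.
by rewrite expr1 mulN1r opprK.
Qed.

(** The codomain [K^o] is K as a vector space over itself, so that [linfun] and the rank formula
    apply to the trace. *)
Definition sigma1_regular y : K^o := sigma 1 y.

Lemma sigma1_linear : linear sigma1_regular.
Proof. by move=> c x y; rewrite /sigma1_regular !sigma1_trace !linearP. Qed.

HB.instance Definition _ := GRing.isSemilinear.Build K L K^o _ sigma1_regular
  (GRing.semilinear_linear sigma1_linear).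

(* With m = t^2 - a t - b the minimal polynomial of y, the characteristic
   polynomial is m^3, whence sigma_1 y = 3 a = a. *)
Lemma sigma1_quadratic y : separable 1%VS {:L} -> \dim <<1; y>>%VS = 2%N ->
  sigma 1 y != 0.
Proof.
move=> sepL dy.
have ny : y \notin 1%VS.
  by rewrite -(adjoin_deg_eq1 1%AS) adjoin_degree1E dy.
have [q] := pow_dim_horner y; rewrite dy => szq; rewrite horner_alg_size2 //.
move: (q`_0) (q`_1) => b a y2.
pose m : {poly K} := 'X^2 - a *: 'X - b%:P.
have coefm i : m`_i = nth 0 [:: - b; - a; 1] i.
  rewrite !(coefB, coefZ, coefXn, coefX, coefC).
  by case: i => [|[|[|i]]] /=; rewrite ?nth_nil; ring.
have szm : size m = 3%N.
  apply/eqP; rewrite eqn_leq; apply/andP; split.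
    by apply/leq_sizeP=> i lei; rewrite coefm nth_default.
  by rewrite ltnNge; apply/negP=> /leq_sizeP/(_ 2%N isT)/eqP;
    rewrite coefm oner_eq0.
have mm : m \is monic by rewrite monicE lead_coefE szm coefm.
have hm r : (map_poly (in_alg L) m).[r] = r ^+ 2 - in_alg L a * r - in_alg L b.
  rewrite !rmorphB /= map_polyZ map_polyXn map_polyX map_polyC /=.
  by rewrite !(hornerD, hornerN, hornerZ, hornerXn, hornerX, hornerC).
have na : a != 0.
  have : separable_element 1 y by apply: (separableP sepL); rewrite memvf.
  rewrite separable_nz_der; apply: contraNneq => a0.
  rewrite (@minPoly_of_root y m) ?dy //; last first.
    by apply/rootP; rewrite hm y2; ring.
  apply/eqP/polyP=> i; rewrite coef0 coef_deriv coef_map coefm.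
  case: i => [|[|i]] /=; first by rewrite a0 oppr0 scale0r mul0rn.
    by rewrite scale1r h2L.
  by rewrite nth_nil scale0r mul0rn.
(* If r in K is a root of m, the other one is a - r, so y would be one of them and lie in K. *)
have im : irreducible_poly m.
  apply: cubic_irreducible; rewrite ?szm // => r; apply/negP=> /rootP mr.
  have : (y - in_alg L r) * (y + in_alg L (r - a)) = 0.
    have : in_alg L m.[r] = 0 by rewrite mr rmorph0.
    rewrite -horner_map hm => r2.
    transitivity (y ^+ 2 - in_alg L a * y - in_alg L b
        - (in_alg L r ^+ 2 - in_alg L a * in_alg L r - in_alg L b)).
      by ring.
    by rewrite r2 y2; ring.
  move/eqP; rewrite mulf_eq0 subr_eq0 addr_eq0 => /orP[] /eqP yE; case/negP: ny.
    by rewrite yE in_alg1.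
  by rewrite yE rpredN in_alg1.
pose M := mxof (vbasis {:L}) (vbasis {:L}) (amull y).
have M2 : M *m M = a *: M + b%:M.
  have eb := vbasisP {:L}.
  rewrite -mxof_comp // -[b%:M]scalemx1 -(mxof1 (basis_free eb)).
  rewrite -!linearZ -linearD.
  congr mxof; apply/lfunP=> z; rewrite !lfunE /= !lfunE /=.
  by rewrite id_lfunE mulrA -expr2 y2 mulrDl !mulr_algl addrC.
have [|j qE] :=
  @monic_dvd_irredp_exp _ _ _ (\dim {:L}) im mm (char_poly_monic M).
  exact: char_poly_dvd_quadratic M2.
have j3 : j = 3%N.
  have := size_exp m j; rewrite -qE size_char_poly degL szm mul2n => e.
  by rewrite -[LHS]doubleK -e.
have m35 : (m ^+ 3)`_5 = a.
  rewrite exprS expr2 !(coefM, big_ord_recr, big_ord0) /= !coefm /=.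
  rewrite !oppr_pchar2 //.
  by char2_ring h2K.
by rewrite /sigma degL /mul_char_poly -/M qE j3 /= m35 expr1 mulN1r oppr_eq0.
Qed.

Lemma exists_trace0_sigma3_0 : C1_field K ->
  exists y, [/\ y \notin 1%VS, sigma 1 y = 0 & sigma 3 y = 0].
Proof.
move=> C1; pose M y := mxof (vbasis {:L}) (vbasis {:L}) (amull y).
pose T := linfun sigma1_regular.
have TE y : T y = sigma 1 y by rewrite lfunE.
pose U := (lker T :\: 1)%VS; pose e := vbasis U.
(* The kernel of the trace has dimension at least 6 - 1, and removing K costs at most one more. *)
have dU : (3 < \dim U)%N.
  have := limg_ker_dim T fullv; rewrite capfv degL.
  have : (\dim (limg T) <= 1)%N by rewrite (leq_trans (dimvS (subvf _))) ?dimvf.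
  have := dimv_cap_compl (lker T) 1%VS.
  have : (\dim (lker T :&: 1) <= 1)%N.
    by rewrite -[X in (_ <= X)%N](dimv1 L) dimvS ?capvSr.
  rewrite -/U; lia.
(* The matrix of multiplication by the generic element of U. The t^3 coefficient of its
   characteristic polynomial is a form of degree 6 - 3, equal to sigma_3 up to sign at each point of
   U. *)
pose A : 'M[{mpoly K[\dim U]}]_(\dim {:L}) :=
  \matrix_(r, s) \sum_(i < \dim U) M e`_i r s *: 'X_i.
have A1 r s : A r s \is 1.-homog.
  rewrite mxE rpred_sum // => i _; apply/rpredZ.
  by rewrite dhomogX /= mdeg1.
have hom3 : (char_poly A)`_3 \is 3.-homog.
  by have := char_poly_homog A1 3%N; move: (char_poly A) => q; rewrite degL.
have [v [[i vi] fv]] := C1 _ _ _ (isT : (0 < 3)%N) dU hom3.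
pose y := \sum_(i < \dim U) v i *: e`_i.
have Uy : y \in U.
  by apply: rpred_sum => j _; rewrite rpredZ // vbasis_mem ?mem_nth ?size_tuple.
have y0 : y != 0.
  apply: contraNneq vi => y0; apply/eqP.
  by have /freeP/(_ _ y0) := basis_free (vbasisP U).
exists y; split.
(* U meets K only in 0, so the nonzero y is outside K. *)
- apply: contra y0 => y1; rewrite -memv0 -(capv_diff (lker T) 1%VS).
  by rewrite memv_cap Uy.
- by have := subvP (diffvSl _ _) _ Uy; rewrite memv_ker TE => /eqP.
- rewrite /sigma degL /mul_char_poly -/(M y) /=.
  suff -> : M y = map_mx (meval v) A.
    by rewrite -map_char_poly coef_map /= fv mulr0.
  apply/matrixP=> r s; rewrite [RHS]mxE [A r s]mxE raddf_sum.
  rewrite /M /y !linear_sum summxE; apply: eq_bigr => j _ /=.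
  by rewrite mevalZ mevalXU !linearZ [LHS]mxE mulrC.
Qed.

Lemma exists_generator_sigma13 : separable 1%VS {:L} ->
    (exists F, \dim F = 3%N) \/ C1_field K ->
  exists y, [/\ <<1%VS; y>>%VS = {:L}%VS, sigma 1 y = 0 & sigma 3 y = 0].
Proof.
move=> sepL [[F dF]|C1]; first exact: exists_of_cubic_subfield dF.
have [y [ny s1 s3]] := exists_trace0_sigma3_0 C1.
have : \dim <<1; y>>%VS \in divisors 6.
  by rewrite -dvdn_divisors // -degL field_dimS ?subvf.
rewrite !inE => /or4P[] /eqP d.
- by case/negP: ny; rewrite -(adjoin_deg_eq1 1%AS) adjoin_degree1E d.
- by have /eqP[] := sigma1_quadratic sepL d.
- exact: (@exists_of_cubic_subfield <<1; y>>%AS).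
- by exists y; split=> //; apply/eqP; rewrite eqEdim subvf d degL.
Qed.

End Extension.

Theorem theorem4 (K : fieldType) (L : fieldExtType K)
    (charK : 2%N \in [pchar K])
    (degL : \dim {:L} = 6%N)
    (sepL : separable 1%VS {:L})
    (hab : (exists L' : {subfield L}, \dim L' = 3%N) \/ C1_field K) :
  (exists y : L,
     [/\ <<1%VS; y>>%VS = {:L}%VS, sigma 1 y = 0 & sigma 3 y = 0]) /\
  (forall y : L, <<1%VS; y>>%VS = {:L}%VS ->
     (sigma 1 y = 0 /\ sigma 3 y = 0) <->
     exists a b c d : K,
       minPoly 1%VS y =
         map_poly (in_alg L)
           ('X^6 + a *: 'X^4 + b *: 'X^2 + c *: 'X + d%:P)).
Proof.
by split; [apply: exists_generator_sigma13 | apply: sigma13_minPoly].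
Qed.
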